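(* Let $\beta,h,\theta>0$ and suppose lead times are exponentially distributed with mean $1/\beta$. Let $f(r)>0$ satisfy $f(r)/r\to0$ and $f(r)/\sqrt r\to\infty$ as $r\to\infty$. Consider the GBS policy with parameters $x_*\equiv0$, $f=f(r)$ and positive-integer $\gamma=\gamma(r)$ chosen so that $\mathbb E|Y^r(\infty)|/\sqrt r\to0$ as $r\to\infty$ (such a choice of $\gamma(r)$ exists), and let $\mathcal C^r_{GBS}$ be its long-run average cost in the system with demand rate $r$. Let $\mathcal C^r_{CBS}$ be the long-run average cost under the CBS policy with base-stock level $X_{**}(r)\in\mathbb Z$, where the dependence of $X_{**}(r)$ on $r$ is arbitrary. Then $$\frac{\mathcal C^r_{GBS}}{\mathcal C^r_{CBS}}\to 0,\qquad r\to\infty .$$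
   Context: Notation: $a\vee b=\max\{a,b\}$, $a\wedge b=\min\{a,b\}$, $a^+=a\vee0$, $a^-=(-a)^+$; $\lceil a\rceil$ is the smallest integer $\ge a$. The parameter $r$ runs along an increasing sequence of positive reals tending to infinity. Model. Demand units (customers) arrive as a Poisson process of rate $r$. Each ordered supply unit (item) arrives after a lead time; lead times are i.i.d. (and independent of demand), here exponential with mean $1/\beta$. $Y^r(t)\in\mathbb Z$ is the net inventory level (inventory on hand minus backlog) and $Z^r(t)\in\mathbb Z_+$ is the number of in-transit items (ordered, not yet arrived). A customer arrival decreases $Y^r$ by 1; an item arrival increases $Y^r$ by 1 and decreases $Z^r$ by 1; ordering an item increases $Z^r$ by 1. The long-run average cost, with holding cost rate $h$ and backlog cost rate $\theta$, is $\mathcal C=h\,\mathbb E[Y^r(\infty)]^++\theta\,\mathbb E[Y^r(\infty)]^-$, where $Y^r(\infty)$ denotes the net inventory level in the stationary regime. CBS (constant base stock) policy with integer level $X_{**}$: orders are placed so that $Y^r(t)+Z^r(t)=X_{**}$ at all times; equivalently, exactly one item is ordered at each customer arrival and no item is ordered at other times. GBS policy with parameters $\gamma>0$, $f>0$, $x_*\in\mathbb R$. Let $X_*^r=r/\beta$, and for a net inventory level $y$ let $X^r=X_*^r-\gamma(y-x_* )$ and $T^r(y)=[X^r\wedge(X_*^r+f)]\vee 0$. At each customer or item arrival: first $Y$ and $Z$ are updated for the arrival, then $T$ is recomputed from the new $Y$, then $A=\lceil T-Z\rceil\vee 0$ new items are ordered, $Z:=Z+A$. Thus $(Y^r(t),Z^r(t))$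 is a continuous-time Markov chain with transitions $$(y,z)\to\bigl(y-1,\ z\vee\lceil T^r(y-1)\rceil\bigr)\ \text{at rate } r,\qquad (y,z)\to\bigl(y+1,\ (z-1)\vee\lceil T^r(y+1)\rceil\bigr)\ \text{at rate }\beta z ,$$ considered on the set of states reachable from the states $(y,\lceil X_*^r+f\rceil)$ with $y$ sufficiently negative (other states are transient). *)

(* Defs.v *)
From Stdlib Require Import Relation_Operators.
From mathcomp Require Import all_boot all_order all_algebra.
From mathcomp Require Import all_classical all_reals all_analysis.
Import Order.TTheory GRing.Theory Num.Theory.
Import numFieldNormedType.Exports.

Set Implicit Arguments.
Unset Strict Implicit.
Unset Printing Implicit Defensive.

Local Open Scope classical_set_scope.
Local Open Scope ring_scope.

Section MarkovChain.
Context {R : realType} {S : choiceType}.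
Implicit Types (q : S -> S -> R) (E : set S) (p : S -> R).

(* [q s t] is the transition rate from s to t, for s != t; the value of q on
   the diagonal is irrelevant below. *)
Definition reachable q : S -> S -> Prop :=
  clos_refl_trans S (fun s t => 0 < q s t).

(* Stationary distribution, carried by E, of the chain with rates q: a
   probability mass function satisfying the global balance equations (total
   flow out of s = total flow into s).  The chains considered in this file are
   non-explosive, so that these equations do characterize the invariant
   distributions. *)
Record stationary_dist q E p : Prop := StationaryDist {
  stationary_ge0 : forall s, 0 <= p s;
  stationary_supp : forall s, ~ E s -> p s = 0;
  stationary_sum1 : \esum_(s in setT) (p s)%:E = 1%E;
  stationary_balance : forall s,
    \esum_(t in setT) (p s * q s t)%:E = \esum_(t in setT) (p t * q t s)%:E }.

(* Expectation of a nonnegative function; it may be +oo. *)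
Definition mean p (g : S -> R) : \bar R := \esum_(s in setT) (p s * g s)%:E.

End MarkovChain.

(* A state is (net inventory level, number of in-transit items). *)
Definition state := (int * nat)%type.

(* The number of items ordered at a customer arrival, resp. at an item arrival,
   as a function of the values of (y, z) already updated for that arrival. *)
Record policy := Policy {
  order_at_customer : int -> nat -> nat;
  order_at_item : int -> nat -> nat }.

Definition after_customer (P : policy) (s : state) : state :=
  (s.1 - 1, (s.2 + order_at_customer P (s.1 - 1) s.2)%N).

(* [s.2.-1] is truncated at s.2 = 0, but item arrivals then have rate 0. *)
Definition after_item (P : policy) (s : state) : state :=
  (s.1 + 1, (s.2.-1 + order_at_item P (s.1 + 1) s.2.-1)%N).

Section Model.
Context {R : realType}.

(* Demand rate r; exponential lead times with mean beta^-1. *)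
Definition rate (beta r : R) (P : policy) (s t : state) : R :=
  r *+ (t == after_customer P s) + beta * s.2%:R *+ (t == after_item P s).

Definition mean_abs_inventory (p : state -> R) : \bar R :=
  mean p (fun s => `|s.1%:~R|).

Definition cost (h theta : R) (p : state -> R) : \bar R :=
  (h%:E * mean p (fun s => (Num.max s.1%:~R 0)%R)
   + theta%:E * mean p (fun s => (Num.max (- s.1%:~R) 0)%R))%E.

Definition cbs_policy : policy := Policy (fun _ _ => 1%N) (fun _ _ => 0%N).

Definition cbs_stationary (beta r : R) (X : int) : (state -> R) -> Prop :=
  stationary_dist (rate beta r cbs_policy)
                  [set s : state | s.1 + s.2%:Z = X].

Section GBS.
Variables (beta r gamma f xstar : R).

Definition gbs_target (y : int) : R :=
  Num.max (Num.min (r / beta - gamma * (y%:~R - xstar)) (r / beta + f)) 0.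

Definition gbs_order (y : int) (z : nat) : nat :=
  `|Num.max (Num.ceil (gbs_target y - z%:R)) 0|%N.

Definition gbs_policy : policy := Policy gbs_order gbs_order.

Definition gbs_start (y : int) : state := (y, `|Num.ceil (r / beta + f)|%N).

Definition gbs_states : set state :=
  [set s | exists y0 : int, forall y : int, y <= y0 ->
     reachable (rate beta r gbs_policy) (gbs_start y) s].

Definition gbs_stationary : (state -> R) -> Prop :=
  stationary_dist (rate beta r gbs_policy) gbs_states.

End GBS.

(* Admissible choice of the positive integers gamma(r), with pi(r) the law of
   the chain in the stationary regime: the stationary regime exists along the
   sequence, x_* = 0, and E|Y^r(oo)| / sqrt r -> 0. *)
Definition gbs_admissible (beta : R) (r : nat -> R) (f : R -> R)
    (gamma : R -> nat) (pi : R -> state -> R) : Prop :=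
  [/\ forall n, (0 < gamma (r n))%N,
      forall n, gbs_stationary beta (r n) (gamma (r n))%:R (f (r n)) 0 (pi (r n))
    & (mean_abs_inventory (pi (r n)) / (Num.sqrt (r n))%:E)%E
        @[n --> \oo] --> (0 : \bar R)].

End Model.

(* Main.v *)
Require Import Defs.
From mathcomp Require Import all_boot all_order all_algebra.
From mathcomp Require Import all_classical all_reals all_analysis.
From mathcomp Require Import zify ring lra.
Import Order.TTheory GRing.Theory Num.Theory.
Import numFieldNormedType.Exports.

Local Open Scope classical_set_scope.
Local Open Scope ring_scope.

(** Under CBS the in-transit count is Poisson with mean [a = r / beta], whose
    weights are [O(1 / sqrt r)], so [E|Y| >= c sqrt r] whatever the base stock
    level; the cost ratio is then controlled by [E|Y| / sqrt r] under GBS.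

    For GBS with integer gain [k], put [u = z - a], so that [y] has drift
    [beta u] and the test functions [y], [y^2] give [E[- u Y] <= a].  The
    overshoot [v = (z + k y - ceil a)^+] behaves like a reflected random walk with
    jumps [- k] and [k - 1], and the test function [v^3] gives
    [E v^2 <= 30 k^4] as long as [k f << r].  Pointwise, [- u y] dominates
    [min (k y^2 / 2, f |y|) - (v + 1)^2 / (2 k)], whence
    [E|Y| = O(sqrt (r / k) + r / f)] when [k^3 <= a], which is [o(sqrt r)] as soon
    as [k] tends slowly to infinity.

    Below level [- ceil (a + f)] the in-transit count is constantly
    [ceil (a + f)] and the chain is a birth-death chain, so the stationary law is
    obtained by prolonging geometrically the stationary law of the finite chain
    restricted to the higher levels. *)

(** * Stationary laws of finite chains *)

(* The rate matrix kills constants, so it has a nonzero left null vector [v];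
   then [`|v|] is subinvariant, hence invariant since the total flows agree. *)
Lemma ord_stationary (R : realFieldType) (n : nat) (q : 'I_n.+1 -> 'I_n.+1 -> R) :
  (forall i j, 0 <= q i j) ->
  exists p : 'I_n.+1 -> R,
    [/\ forall i, 0 <= p i, \sum_i p i = 1
      & forall g : 'I_n.+1 -> R,
          \sum_i p i * (\sum_j q i j * (g j - g i)) = 0].
Proof.
move=> q0.
pose out i := \sum_k q i k.
pose Q : 'M[R]_n.+1 := \matrix_(i, j) (q i j - (i == j)%:R * out i).
have detQ : \det Q == 0.
  rewrite -det_tr; apply/det0P; exists (const_mx 1).
    by apply/eqP => /rowP /(_ ord0); rewrite !mxE => /eqP; rewrite oner_eq0.
  apply/rowP => i; rewrite !mxE.
  under eq_bigr do rewrite !mxE mul1r.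
  rewrite sumrB (bigD1 i (F := fun j => (i == j)%:R * _)) //= eqxx mul1r.
  rewrite [X in _ - (_ + X)]big1 ?addr0 ?subrr // => j /negPf; rewrite eq_sym => ->.
  by rewrite mul0r.
have /det0P[v v0 vQ] := detQ.
have bal j : \sum_i v 0 i * q i j = v 0 j * out j.
  move/rowP: vQ => /(_ j); rewrite !mxE.
  under eq_bigr do rewrite !mxE mulrBr.
  rewrite sumrB => /eqP; rewrite subr_eq0 => /eqP ->.
  rewrite (bigD1 j) //= eqxx mul1r [X in _ + X]big1 ?addr0 // => i /negPf ->.
  by rewrite mul0r mulr0.
have out0 i : 0 <= out i by exact: sumr_ge0.
have sub j : `|v 0 j| * out j <= \sum_i `|v 0 i| * q i j.
  rewrite -{1}(ger0_norm (out0 j)) -normrM -bal (le_trans (ler_norm_sum _ _ _)) //.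
  by apply: ler_sum => i _; rewrite normrM (ger0_norm (q0 i j)).
have tot : \sum_j (\sum_i `|v 0 i| * q i j - `|v 0 j| * out j) = 0.
  rewrite sumrB exchange_big /= -sumrB big1 // => i _.
  by rewrite -mulr_sumr subrr.
have abal j : \sum_i `|v 0 i| * q i j = `|v 0 j| * out j.
  apply/eqP; rewrite -subr_eq0; apply/eqP.
  by apply: (psumr_eq0P _ tot) => // i _; rewrite subr_ge0.
pose S := \sum_i `|v 0 i|.
have S0 : S != 0.
  apply: contra v0 => /eqP /psumr_eq0P v0; apply/eqP/rowP => i.
  by rewrite !mxE; apply: normr0_eq0; exact: v0.
have Sge : 0 <= S by exact: sumr_ge0.
exists (fun i => `|v 0 i| / S); split => [i||g].
- by rewrite divr_ge0.
- by rewrite -mulr_suml divff.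
- under eq_bigr => i _.
    under eq_bigr do rewrite mulrBr.
    rewrite sumrB -mulr_suml mulrBr mulr_sumr; over.
  rewrite sumrB exchange_big /= -sumrB big1 // => j _.
  transitivity (g j / S * (\sum_i `|v 0 i| * q i j - `|v 0 j| * out j)); last first.
    by rewrite abal subrr mulr0.
  rewrite mulrBr mulr_sumr; congr (_ - _); last by rewrite /out; ring.
  by apply: eq_bigr => i _; ring.
Qed.

Lemma seq_stationary (R : realFieldType) (T : eqType) (F : seq T) (q : T -> T -> R) :
  uniq F -> F != [::] -> (forall s t, 0 <= q s t) ->
  exists p : T -> R,
    [/\ forall s, 0 <= p s, forall s, s \notin F -> p s = 0,
        \sum_(s <- F) p s = 1
      & forall g : T -> R,
          \sum_(s <- F) p s * (\sum_(t <- F) q s t * (g t - g s)) = 0].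
Proof.
case: F => // x0 F uF _ q0; set G := x0 :: F in uF *.
have [p [p0 p1 pbal]] :=
  ord_stationary R (size F) (fun i j => q (nth x0 G i) (nth x0 G j))
    (fun i j => q0 _ _).
pose p' s := if s \in G then p (inord (index s G)) else 0.
have p'E (i : 'I_(size F).+1) : p' (nth x0 G i) = p i.
  by rewrite /p' mem_nth// index_uniq// inord_val.
have sumE (f : T -> R) : \sum_(s <- G) f s = \sum_(i < (size F).+1) f (nth x0 G i).
  by rewrite (big_nth x0) big_mkord.
exists p'; split => [s|s /negPf|| g].
- by rewrite /p'; case: ifP.
- by rewrite /p' => ->.
- by rewrite sumE -p1; apply: eq_bigr => i _; exact: p'E.
- rewrite sumE -[RHS](pbal (fun i => g (nth x0 G i))).
  by apply: eq_bigr => i _; rewrite p'E sumE.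
Qed.

(** * Unconditional sums over countable sets *)

Lemma esum_seq (R : realType) (T : choiceType) (F : seq T) (h : T -> R) :
  uniq F -> (forall x, 0 <= h x) -> (forall x, x \notin F -> h x = 0) ->
  \esum_(x in setT) (h x)%:E = (\sum_(x <- F) h x)%:E.
Proof.
move=> uF h0 hF.
have hE : \esum_(x in setT) (h x)%:E = \esum_(x in [set` F]) (h x)%:E.
  rewrite [RHS]esum_mkcond; apply: eq_esum => x _.
  case: ifPn => // /negP xF; rewrite hF //; apply/negP => xF'.
  by apply: xF; rewrite inE.
rewrite hE esum_fset; last 2 first.
- exact: finite_seq.
- by move=> x _; rewrite lee_fin.
by rewrite -fsbig_seq// sumEFin.
Qed.

Lemma esum_delta (R : realType) (T : choiceType) (c : R) (x : T) : 0 <= c ->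
  \esum_(t in setT) (c *+ (t == x))%:E = c%:E.
Proof.
move=> c0; rewrite (esum_seq _ _ [:: x]) ?big_seq1 ?eqxx ?mulr1n//.
  by move=> t; rewrite mulrn_wge0.
by move=> t; rewrite inE => /negPf ->.
Qed.

Lemma sum_le_esum (R : realType) (T : choiceType) (F : seq T) (h : T -> R) :
  uniq F -> ((\sum_(x <- F) h x)%:E <= \esum_(x in setT) (h x)%:E)%E.
Proof.
move=> uF; apply: (@le_trans _ _ (\sum_(x \in [set` F]) (h x)%:E)%E).
  by rewrite -fsbig_seq// sumEFin.
by apply: ereal_sup_ubound; exists [set` F].
Qed.

(** A finite set meets the support of [h] in finitely many points, and since the lists increase a
    single [F j] contains them all. Infinite sums over states are thereby reduced to sums over
    truncations of the state space. *)
Lemma esum_sup_seq (R : realType) (T : choiceType) (F : nat -> seq T) (h : T -> R) :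
  (forall j, uniq (F j)) -> (forall i j, (i <= j)%N -> {subset F i <= F j}) ->
  (forall x, 0 <= h x) -> (forall x, h x != 0 -> exists j, x \in F j) ->
  \esum_(x in setT) (h x)%:E
    = ereal_sup (range (fun j => (\sum_(x <- F j) h x)%:E)).
Proof.
move=> uF sF h0 hF; apply/eqP; rewrite eq_le; apply/andP; split.
- apply: ub_ereal_sup => _ /= [A [finA _] <-].
  have [B uB AB] : exists2 B : seq T, uniq B & A = [set` B].
    exists (finmap.enum_fset (fset_set A)); first exact: finmap.fset_uniq.
    exact/esym/fset_setK.
  have [j hj] : exists j, forall x, x \in B -> h x != 0 -> x \in F j.
    elim: B {AB uB} => [|b B [j hj]]; first by exists 0%N.
    have [hb|hb] := eqVneq (h b) 0.
      by exists j => x; rewrite inE => /orP[/eqP ->|/hj//]; rewrite hb eqxx.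
    have [i bi] := hF _ hb; exists (maxn i j) => x.
    rewrite inE => /orP[/eqP -> _|xB hx].
      by apply: sF bi; exact: leq_maxl.
    by apply: sF (hj _ xB hx); exact: leq_maxr.
  apply: (@le_trans _ _ (\sum_(x <- F j) h x)%:E); last first.
    by apply: ereal_sup_ubound; exists j.
  rewrite AB -fsbig_seq// sumEFin lee_fin (bigID (fun x => h x != 0)) /=.
  rewrite [X in _ + X]big1 ?addr0; last by move=> x /negbNE/eqP.
  rewrite -big_filter; set C := [seq x <- B | h x != 0].
  rewrite [leRHS](bigID (fun x => x \in C)) /= -[X in _ <= X + _]big_filter.
  rewrite -[leLHS]addr0 lerD ?sumr_ge0 // le_eqVlt; apply/orP; left.
  apply/eqP/perm_big/uniq_perm; rewrite ?filter_uniq// => x.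
  rewrite !mem_filter /=; case hx: (h x != 0) => //=.
  by case xB: (x \in B) => //=; rewrite hj.
- by apply: ub_ereal_sup => _ /= [j _ <-]; exact: sum_le_esum.
Qed.

(** * Rates and the generator *)

Lemma esum_rate_out (R : realType) (beta r : R) (P : policy) (p : state -> R)
    (s : state) : 0 <= beta -> 0 <= r -> 0 <= p s ->
  \esum_(t in setT) (p s * rate beta r P s t)%:E = (p s * (r + beta * s.2%:R))%:E.
Proof.
move=> beta0 r0 p0.
transitivity (\esum_(t in setT) ((p s * r *+ (t == after_customer P s))%:E
    + (p s * (beta * s.2%:R) *+ (t == after_item P s))%:E)%E).
  by apply: eq_esum => t _; rewrite -EFinD /rate mulrDr !mulrnAr.
have psr : 0 <= p s * r by rewrite mulr_ge0.
have psb : 0 <= p s * (beta * s.2%:R) by rewrite !mulr_ge0.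
rewrite esumD ?esum_delta// -?EFinD -?mulrDr//.
  by move=> t _; rewrite lee_fin mulrn_wge0.
by move=> t _; rewrite lee_fin mulrn_wge0.
Qed.

(** The sum runs over the two arrival events instead of over target states, so it is finite for
    every test function. *)
Definition generator {R : realType} (beta r : R) (P : policy) (g : state -> R)
    (s : state) : R :=
  r * (g (after_customer P s) - g s) + beta * s.2%:R * (g (after_item P s) - g s).

Lemma sum_seq_delta (R : pzRingType) (T : eqType) (F : seq T) (c : R) (x : T)
  (h : T -> R) : uniq F ->
  \sum_(t <- F) (c *+ (t == x)) * h t = (c * h x) *+ (x \in F).
Proof.
elim: F => [|y F ih] /=; first by rewrite big_nil.
move=> /andP[yF uF]; rewrite big_cons ih// inE eq_sym.
case: eqVneq => [->|_]; last by rewrite mulr0n mul0r add0r.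
by rewrite (negPf yF) !mulr1n addr0.
Qed.

(** * Roundings and cubic increments *)

Lemma ceil_max {R : realType} (x y : R) :
  Num.ceil (Num.max x y) = Num.max (Num.ceil x) (Num.ceil y).
Proof.
by case: (leP x y) => h; [rewrite !max_r | rewrite !max_l]; rewrite ?le_ceil// ltW.
Qed.

Lemma ceil_min {R : realType} (x y : R) :
  Num.ceil (Num.min x y) = Num.min (Num.ceil x) (Num.ceil y).
Proof.
by case: (leP x y) => h; [rewrite !min_l | rewrite !min_r]; rewrite ?le_ceil// ltW.
Qed.

(** Expand [(v - c) ^+ 3] and drop [- c ^+ 3]. When the reflection at 0 is active, what remains is
    [v ^+ 2 - 3 * c * v + 3 * c ^+ 2 >= 0], a quadratic with negative discriminant. *)
Lemma cube_decr {R : realType} (v w c : R) :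
  0 <= v -> 0 <= c -> 0 <= w -> w <= Num.max (v - c) 0 ->
  w ^+ 3 - v ^+ 3 <= - 3 * c * v ^+ 2 + 3 * c ^+ 2 * v.
Proof.
move=> v0 c0 w0; case: (leP (v - c) 0) => vc hw.
  have -> : w = 0 by apply/eqP; rewrite eq_le hw.
  have : 0 <= v * ((v - 3 / 2 * c) ^+ 2 + 3 / 4 * c ^+ 2).
    by rewrite mulr_ge0// addr_ge0 ?sqr_ge0// mulr_ge0// sqr_ge0.
  by rewrite -subr_ge0 => h; rewrite -subr_ge0; apply: le_trans h _; lra.
have : w ^+ 3 <= (v - c) ^+ 3 by rewrite lerXn2r// nnegrE ltW.
have : 0 <= c ^+ 3 by rewrite exprn_ge0.
by move=> ? h; rewrite lerBlDr (le_trans h)//; lra.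
Qed.

Lemma cube_incr {R : realType} (v w c : R) :
  0 <= v -> 0 <= c -> 0 <= w -> w <= v + c ->
  w ^+ 3 - v ^+ 3 <= 3 * c * v ^+ 2 + 3 * c ^+ 2 * v + c ^+ 3.
Proof.
move=> v0 c0 w0 hw.
have : w ^+ 3 <= (v + c) ^+ 3 by rewrite lerXn2r// nnegrE addr_ge0.
by move=> h; rewrite lerBlDr (le_trans h)//; lra.
Qed.

(** * The GBS chain: invariant region and birth-death tail *)

Section GBSChain.
Context {R : realType} (beta r f : R) (k : nat).
Hypotheses (beta_gt0 : 0 < beta) (r_gt0 : 0 < r) (f_gt0 : 0 < f) (k_gt0 : (0 < k)%N).

Let A : int := Num.ceil (r / beta).
Let M : int := Num.ceil (r / beta + f).
Let P := gbs_policy beta r k%:R f 0.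
Let q := rate beta r P.

(** With an integer gain, rounding up commutes with the shift by [k y] and with both truncations, so
    the order-up-to level can be treated by integer arithmetic. *)
Definition gbs_level (y : int) : int := Num.max (Num.min (A - k%:Z * y) M) 0.

Lemma ceil_gbs_target (y : int) :
  Num.ceil (gbs_target beta r k%:R f 0 y) = gbs_level y.
Proof.
rewrite /gbs_target /gbs_level ceil_max ceil_min subr0 ceil0; congr Num.max.
congr Num.min; rewrite ceilDrz ?rpredN ?rpredM ?rpred_nat ?intr_int//.
congr (_ + _).
by rewrite -[k%:R]/(k%:Z%:~R) -intrM -mulrNz intrKceil.
Qed.

Lemma gbs_orderE (y : int) (z : nat) :
  (z + gbs_order beta r k%:R f 0 y z)%:Z = Num.max z%:Z (gbs_level y).
Proof.
rewrite /gbs_order ceilDrz ?rpredN ?rpred_nat// -[z%:R]/(z%:Z%:~R). rewrite ceil_gbs_target.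
rewrite -mulrNz intrKceil; move: (gbs_level y) => N; lia.
Qed.

Lemma base_gt0 : 0 < A.
Proof. by rewrite ceil_gt0 divr_gt0. Qed.

Lemma base_le_cap : A <= M.
Proof. by rewrite le_ceil// lerDl ltW. Qed.

(** The third bound limits [y] from above. It is preserved because for [y] up to [A] it follows from
    the cap on [z], while above [A] the target is 0 and nothing is ordered. *)
Definition gbs_inv (s : state) : Prop :=
  [/\ gbs_level s.1 <= s.2%:Z, s.2%:Z <= M & s.1 + s.2%:Z <= A + M].

Lemma gbs_inv_customer (s : state) : gbs_inv s -> gbs_inv (after_customer P s).
Proof.
have A0 := base_gt0; have AM := base_le_cap.
case: s => y z [/= h1 h2 h3]; rewrite /gbs_inv /after_customer /= gbs_orderE.
move: h1; rewrite /gbs_level => h1.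
have h : A < y -> A - k%:Z * (y - 1) <= 0 by move=> ?; nia.
case: (leP y A) => yA; first by split; lia.
have := h yA => ?; split; lia.
Qed.

Lemma gbs_inv_item (s : state) : (0 < s.2)%N ->
  gbs_inv s -> gbs_inv (after_item P s).
Proof.
have A0 := base_gt0; have AM := base_le_cap.
case: s => y z /= z0 [/= h1 h2 h3]; rewrite /gbs_inv /after_item /= gbs_orderE.
move: h1; rewrite /gbs_level => h1.
case: (ltP y A) => yA; first by split; lia.
have h : A - k%:Z * (y + 1) <= 0 by nia.
split; lia.
Qed.

(** The tail starts at [- M] because there [A - k y >= M] already for [k = 1]: the target has
    reached its cap. *)
Definition gbs_tail (j : nat) : state := gbs_start beta r f (- (M + j%:Z)).

Lemma cap_nat : `|M|%N%:Z = M.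
Proof. have A0 := base_gt0; have AM := base_le_cap; lia. Qed.

Lemma gbs_level_low (y : int) : y <= - M -> gbs_level y = M.
Proof.
have A0 := base_gt0; have AM := base_le_cap; rewrite /gbs_level => yM.
have : M <= A - k%:Z * y by nia.
lia.
Qed.

Lemma gbs_inv_tail (j : nat) : gbs_inv (gbs_tail j).
Proof.
have A0 := base_gt0; have AM := base_le_cap.
rewrite /gbs_inv /gbs_tail /gbs_start /= -/M cap_nat gbs_level_low; last by lia.
split; lia.
Qed.

(** The target equals the cap here, so the invariant squeezes [z] from both sides: each low level
    carries a single state. *)
Lemma gbs_inv_low (s : state) : gbs_inv s -> s.1 <= - M ->
  s = gbs_tail `|(s.1 + M)%R|%N.
Proof.
case: s => y z [/= h1 h2 h3] yM; rewrite gbs_level_low in h1; last by [].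
rewrite /gbs_tail /gbs_start -/M; congr (_, _); lia.
Qed.

Lemma after_customer_tail (j : nat) : after_customer P (gbs_tail j) = gbs_tail j.+1.
Proof.
have I := gbs_inv_customer _ (gbs_inv_tail j).
have:= gbs_inv_low _ I; rewrite /= => -> //; last by lia.
congr gbs_tail; lia.
Qed.

Lemma after_item_tail (j : nat) : after_item P (gbs_tail j.+1) = gbs_tail j.
Proof.
have A0 := base_gt0; have AM := base_le_cap.
have I : gbs_inv (after_item P (gbs_tail j.+1)).
  by apply: gbs_inv_item (gbs_inv_tail _); rewrite /= -/M; lia.
have:= gbs_inv_low _ I; rewrite /= => -> //; last by lia.
congr gbs_tail; lia.
Qed.

Lemma rate_gt0P (s t : state) : 0 < q s t ->
  t = after_customer P s \/ (t = after_item P s /\ (0 < s.2)%N).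
Proof.
rewrite /q /rate; case: eqP => [->|_]; first by left.
case: eqP => [->|_]; last by rewrite !mulr0n addr0 ltxx.
by rewrite mulr0n add0r mulr1n pmulr_rgt0// ltr0n; right.
Qed.

Lemma rate_customer_gt0 (s : state) : 0 < q s (after_customer P s).
Proof.
rewrite /q /rate eqxx mulr1n ltr_wpDr// mulrn_wge0// mulr_ge0//; exact: ltW.
Qed.

Lemma rate_item_gt0 (s : state) : (0 < s.2)%N -> 0 < q s (after_item P s).
Proof.
move=> s0; rewrite /q /rate eqxx mulr1n ltr_wpDl ?mulrn_wge0 ?ltW//.
by rewrite pmulr_rgt0 ?ltr0n.
Qed.

Lemma gbs_reachable_inv (s t : state) : reachable q s t -> gbs_inv s -> gbs_inv t.
Proof.
elim => {s t} [s t /rate_gt0P[->|[-> s0]]||] //; first exact: gbs_inv_customer.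
- exact: gbs_inv_item.
- by move=> s t u _ st _ tu /st.
Qed.

(** * Recurrent states of the GBS chain *)

Let L := generator beta r P.
Local Notation tail := gbs_tail.
Local Notation E := (gbs_states beta r k%:R f 0).

Lemma gbs_states_inv (s : state) : E s -> gbs_inv s.
Proof.
have A0 := base_gt0; have AM := base_le_cap.
move=> [y0 /(_ (- (M + `|y0|%N%:Z)))] h.
by apply: (gbs_reachable_inv _ _ (h _) (gbs_inv_tail _)); lia.
Qed.

Lemma gbs_states_customer (s : state) : E s -> E (after_customer P s).
Proof.
move=> [y0 h]; exists y0 => y /h ys; apply: Relation_Operators.rt_trans ys _.
by apply: Relation_Operators.rt_step; exact: rate_customer_gt0.
Qed.

Lemma gbs_states_item (s : state) : (0 < s.2)%N -> E s -> E (after_item P s).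
Proof.
move=> s0 [y0 h]; exists y0 => y /h ys; apply: Relation_Operators.rt_trans ys _.
by apply: Relation_Operators.rt_step; exact: rate_item_gt0.
Qed.

(** From any start further down, item arrivals alone climb the tail one level at a time. *)
Lemma gbs_states_tail (j : nat) : E (gbs_tail j).
Proof.
have A0 := base_gt0; have AM := base_le_cap.
exists (- (M + j%:Z)) => y yj.
have -> : gbs_start beta r f y = gbs_tail (j + `|(- (M + j%:Z) - y)%R|%N).
  by rewrite /gbs_tail /gbs_start; congr (_, _); lia.
move: `|_|%N => i; elim: i => [|i ih].
  by rewrite addn0; exact: Relation_Operators.rt_refl.
apply: Relation_Operators.rt_trans ih; apply: Relation_Operators.rt_step.
rewrite addnS -(after_item_tail (j + i)); apply: rate_item_gt0 => /=; rewrite -/M; lia.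
Qed.

(** The invariant confines [y] to [[- M, A + M]] and [z] to [[0, M]], a finite box. *)
Lemma gbs_head_exists : exists F : seq state, uniq F /\
  forall s, (s \in F) <-> (E s /\ - M <= s.1).
Proof.
have A0 := base_gt0; have AM := base_le_cap.
pose box := [seq (i%:Z - M, z) | i <- iota 0 `|(A + M + M + 1)%R|%N, z <- iota 0 `|(M + 1)%R|%N].
exists (undup [seq s <- box | `[< E s /\ - M <= s.1 >]]).
split; first exact: undup_uniq.
move=> s; rewrite mem_undup mem_filter; split; first by move=> /andP[/asboolP].
move=> Es; apply/andP; split; first exact/asboolP.
case: Es => /gbs_states_inv[h1 h2 h3] h4; case: s => y z /= in h1 h2 h3 h4 *.
apply/allpairsP; exists (`|(y + M)%R|%N, z) => /=; rewrite !mem_iota; split; try lia.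
congr (_, _); lia.
Qed.

(** * Construction of the stationary flow *)

Let M0 : 0 < M.
Proof. exact: lt_le_trans base_gt0 base_le_cap. Qed.

(** In the tail, items arrive faster than demand; this makes the geometric ratio of the tail less
    than 1. *)
Lemma beta_cap_gt : r < beta * M%:~R.
Proof.
have := ceil_ge (r / beta + f); rewrite -/M => h.
have : beta * (r / beta + f) <= beta * M%:~R by rewrite ler_pM2l.
rewrite mulrDr mulrCA divff ?gt_eqF// mulr1; apply: lt_le_trans.
by rewrite ltrDl mulr_gt0.
Qed.

Lemma tail2 (j : nat) : (tail j).2%:R = M%:~R :> R.
Proof. by rewrite -[in RHS]cap_nat. Qed.

(* Only downward jumps from the lowest level [tail j] leave [F j]: for every
   test function the truncated drift is a single boundary term. *)
Lemma gbs_flow : exists (F : nat -> seq state) (p : state -> R) (c rho : R),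
  [/\ forall j, uniq (F j),
      forall j (s : state), (s \in F j) <-> (E s /\ - (M + j%:Z) <= s.1),
      forall s, 0 <= p s,
      forall s, ~ E s -> p s = 0
    & [/\ 0 <= c, 0 <= rho < 1, forall j, \sum_(s <- F j) p s = 1 - c * rho ^+ j
      & forall j (g : state -> R), \sum_(s <- F j) p s * L g s
          = p (tail j) * r * (g (tail j.+1) - g (tail j))]].
Proof.
have [F0 [uF0 F0P]] := gbs_head_exists.
rewrite -/M in F0P.
have Etail j : E (tail j) by exact: gbs_states_tail.
have tail0F : tail 0 \in F0 by apply/F0P; split => //=; rewrite -/M; lia.
have [pi [pi0 piF pi1 pibal]] : exists p : state -> R,
    [/\ forall s, 0 <= p s, forall s, s \notin F0 -> p s = 0,
        \sum_(s <- F0) p s = 1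
      & forall g : state -> R,
          \sum_(s <- F0) p s * (\sum_(t <- F0) q s t * (g t - g s)) = 0].
  apply: seq_stationary => //; first by case: (F0) tail0F.
  move=> s t; rewrite /q /rate addr_ge0// mulrn_wge0 ?mulr_ge0//; exact: ltW.
(* Restriction to [F0] suppresses exactly one jump, from [tail 0] down to [tail 1], which the extra
   term restores. An item arrival at [z = 0] might leave [F0] formally, but has rate 0. *)
have genF0 g s : s \in F0 -> L g s = \sum_(t <- F0) q s t * (g t - g s)
    + r * (g (tail 1) - g (tail 0)) *+ (s == tail 0).
  move=> sF; have [Es sM] := iffLR (F0P s) sF.
  have inv := gbs_states_inv s Es.
  rewrite /q /rate; under eq_bigr do rewrite mulrDl.
  rewrite big_split /= (sum_seq_delta _ _ _ _ _ (fun t => g t - g s))//.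
  rewrite (sum_seq_delta _ _ _ _ _ (fun t => g t - g s))// /L /generator -/P.
  have -> : beta * s.2%:R * (g (after_item P s) - g s) *+ (after_item P s \in F0)
          = beta * s.2%:R * (g (after_item P s) - g s).
    have [z0|s0] := posnP s.2; first by rewrite z0 mulr0 !mul0r mul0rn.
    have -> : after_item P s \in F0; last by rewrite mulr1n.
    by apply/F0P; split; [exact: gbs_states_item | move: sM => /=; lia].
  have [st|st] := eqVneq s (tail 0).
    rewrite st /P after_customer_tail// -/P.
    have -> : (tail 1 \in F0) = false.
      by apply/negP => /F0P[_] /=; rewrite -/M; lia.
    by rewrite mulr0n mulr1n; ring.
  have -> : after_customer P s \in F0; last by rewrite mulr1n mulr0n addr0.
  apply/F0P; split; first exact: gbs_states_customer.
  have : s.1 != - M.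
    apply: contra st => /eqP st.
    rewrite (gbs_inv_low s inv) st ?lexx//.
    by rewrite -/M addNr.
  move: sM => /=; lia.
pose F j := iteri j (fun i l => tail i.+1 :: l) F0.
have FP j (s : state) : (s \in F j) <-> (E s /\ - (M + j%:Z) <= s.1).
  elim: j => [|j ih]; first by rewrite addr0.
  rewrite /F iteriS -/(F j) inE; split.
    move=> /orP[/eqP -> | /ih[? ?]]; last by split=> //; lia.
    by split => //=; rewrite -/M; lia.
  move=> [Es sj]; have [sj'|sj'] := boolP (- (M + j%:Z) <= s.1).
    by apply/orP; right; apply/ih.
  apply/orP; left; apply/eqP.
  have inv := gbs_states_inv s Es.
  rewrite (gbs_inv_low s inv) -/M; last by rewrite -/M; lia.
  by congr gbs_tail; lia.
have tailF j : tail j.+1 \notin F j.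
  by apply/negP => /FP[_] /=; rewrite -/M; lia.
have uF j : uniq (F j).
  by elim: j => [//|j ih]; rewrite /F iteriS -/(F j) /= tailF.
pose m : R := beta * M%:~R.
have m0 : 0 < m by exact: lt_trans beta_cap_gt.
(* Detailed balance in the tail: downward rate [r] against upward rate [beta * M]. *)
pose rho := r / m.
have rho01 : 0 <= rho < 1.
  by rewrite divr_ge0 ?(ltW r_gt0) ?(ltW m0)//= ltr_pdivrMr// mul1r beta_cap_gt.
have [rho0 rho1] := andP rho01.
have rhoN : 1 - rho != 0 by rewrite subr_eq0 eq_sym lt_eqF.
pose p0 s := if s \in F0 then pi s else
  if `[< E s >] then pi (tail 0) * rho ^+ `|(s.1 + M)%R|%N else 0.
have p0tail j : p0 (tail j) = pi (tail 0) * rho ^+ j.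
  rewrite /p0; case: j => [|j]; first by rewrite tail0F expr0 mulr1.
  have -> : (tail j.+1 \in F0) = false.
    by apply/negP => /F0P[_] /=; rewrite -/M; clear; lia.
  rewrite (asboolT (Etail _)); congr (_ * _ ^+ _) => /=; rewrite -/M; clear; lia.
have p0ge s : 0 <= p0 s.
  rewrite /p0; case: ifP => // _; case: ifP => // _.
  by rewrite mulr_ge0// exprn_ge0.
have p0E s : ~ E s -> p0 s = 0.
  move=> Es; rewrite /p0 ifN; first by rewrite (asboolF Es).
  by apply/negP => /F0P[].
have sump0 j : \sum_(s <- F j) p0 s
    = 1 + pi (tail 0) * rho / (1 - rho) - pi (tail 0) * rho / (1 - rho) * rho ^+ j.
  elim: j => [|j ih].
    rewrite mulr1 addrK -pi1 /= [LHS]big_seq [RHS]big_seq.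
    by apply: eq_bigr => s sF; rewrite /p0 sF.
  by rewrite /F iteriS -/(F j) big_cons ih p0tail !exprS; field.
(* Total mass: 1 for the head plus the geometric series of the tail below it. *)
pose C := 1 + pi (tail 0) * rho / (1 - rho).
have c0 : 0 <= pi (tail 0) * rho / (1 - rho).
  by rewrite mulr_ge0 ?invr_ge0 ?subr_ge0 ?(ltW rho1)// mulr_ge0.
have C0 : 0 < C by rewrite /C ltr_pwDl.
exists F, (fun s => p0 s / C), (pi (tail 0) * rho / (1 - rho) / C), rho.
split => //.
- by move=> s; rewrite divr_ge0// ltW.
- by move=> s /p0E ->; rewrite mul0r.
split => //; first by rewrite divr_ge0// ltW.
  move=> j; rewrite -mulr_suml sump0 -/C; field.
  by rewrite gt_eqF.
move=> j g; rewrite (_ : \sum_(s <- F j) _ = (\sum_(s <- F j) p0 s * L g s) / C); last first.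
  by rewrite mulr_suml; apply: eq_bigr => s _; ring.
suff -> : \sum_(s <- F j) p0 s * L g s
    = p0 (tail j) * r * (g (tail j.+1) - g (tail j)) by ring.
elim: j => [|j ih].
  transitivity (\sum_(s <- F0) (pi s * (\sum_(t <- F0) q s t * (g t - g s))
     + (r * (g (tail 1) - g (tail 0)) *+ (s == tail 0)) * pi s)).
    rewrite [LHS]big_seq [RHS]big_seq; apply: eq_bigr => s sF.
    by rewrite /p0 sF genF0// mulrDr [X in _ + X]mulrC.
  by rewrite big_split /= pibal add0r sum_seq_delta// tail0F mulr1n /p0 tail0F; ring.
(* The upward term of [tail j.+1] cancels the previous boundary term by detailed balance, leaving
   its downward term as the new boundary. *)
rewrite /F iteriS -/(F j) big_cons ih /L /generator /P after_customer_tail//.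
rewrite after_item_tail// tail2 !p0tail exprS /rho -/m; field.
by rewrite gt_eqF.
Qed.

(** * Moment bounds under GBS *)

Definition overshoot (s : state) : int := Num.max (s.2%:Z + k%:Z * s.1 - A) 0.

(** Ordering creates no overshoot: it fills up at most to the linear target, and where the target is
    truncated at 0 nothing is ordered. Only the shift of [z + k y] by the arrival itself remains. *)
Lemma overshoot_customer (s : state) : gbs_inv s ->
  overshoot (after_customer P s) <= Num.max (overshoot s - k%:Z) 0.
Proof.
case: s => y z [/= h1 h2 h3].
rewrite /overshoot /after_customer /= gbs_orderE /gbs_level; nia.
Qed.

Lemma overshoot_item (s : state) : gbs_inv s -> (0 < s.2)%N ->
  overshoot (after_item P s) <= overshoot s + k%:Z - 1.
Proof.
case: s => y z [/= h1 h2 h3] z0.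
rewrite /overshoot /after_item /= gbs_orderE /gbs_level; nia.
Qed.

Lemma overshoot_tail (j : nat) : overshoot (tail j) = 0.
Proof.
have A0 := base_gt0; rewrite /overshoot /= -/M cap_nat; nia.
Qed.

Let m : R := beta * M%:~R.
Let k1 : 1 <= k%:R :> R.
Proof. by rewrite ler1n. Qed.

(* [30] absorbs, by completing the square, the terms of order [v] left by the two
   cubic expansions. *)
Lemma generator_overshoot_cube (s : state) : k%:R * (m - r) <= r / 2 -> gbs_inv s ->
  L (fun s => (overshoot s)%:~R ^+ 3) s
    <= r * (30 * k%:R ^+ 4 - (overshoot s)%:~R ^+ 2).
Proof.
move=> small_cap I; rewrite /L /generator.
set v : R := (overshoot s)%:~R.
have ov0 t : 0 <= (overshoot t)%:~R :> R by rewrite ler0z /overshoot; lia.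
have v0 : 0 <= v by exact: ov0.
set w1 : R := (overshoot (after_customer _ s))%:~R.
set w2 : R := (overshoot (after_item _ s))%:~R.
have h1 : w1 ^+ 3 - v ^+ 3 <= - 3 * k%:R * v ^+ 2 + 3 * k%:R ^+ 2 * v.
  apply: cube_decr => //; first exact: ov0.
  have := overshoot_customer s I; rewrite -(ler_int R) -/w1 => /le_trans; apply.
  rewrite /v -[k%:R]/(k%:Z%:~R) -intrB.
  by case: (leP (overshoot s - k%:Z) 0); case: (leP ((overshoot s - k%:Z)%:~R) (0:R)) => //;
    rewrite ?ler_int ?ltr_int ?ler0z ?ltr0z//; lia.
have bz : 0 <= beta * s.2%:R <= m.
  rewrite mulr_ge0 ?(ltW beta_gt0)//= /m ler_pM2l//.
  by case: I => _ + _; rewrite -(ler_int R).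
have h2 : beta * s.2%:R * (w2 ^+ 3 - v ^+ 3)
    <= beta * s.2%:R * (3 * (k%:R - 1) * v ^+ 2 + 3 * (k%:R - 1) ^+ 2 * v
       + (k%:R - 1) ^+ 3).
  have [z0|s0] := posnP s.2; first by rewrite z0 mulr0 !mul0r.
  apply: ler_wpM2l; first by case/andP: bz.
  apply: cube_incr => //; rewrite ?subr_ge0//; first exact: ov0.
  have := overshoot_item s I s0.
  by rewrite -(ler_int R) -/w2 intrB intrD -/v -[k%:Z%:~R]/(k%:R) addrA.
have h3 : r * (w1 ^+ 3 - v ^+ 3) <= r * (- 3 * k%:R * v ^+ 2 + 3 * k%:R ^+ 2 * v).
  by rewrite ler_pM2l.
apply: le_trans (lerD h3 h2) _.
move: bz k1 small_cap r_gt0 v0; clearbody v; clear.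
move: (beta * _) (k%:R) (m) v => b K n v /andP[b0 bm] K1 hm r0 v0.
set T := (3 * (K - 1) * v ^+ 2 + 3 * (K - 1) ^+ 2 * v + (K - 1) ^+ 3).
have T0 : 0 <= T by rewrite !addr_ge0 ?mulr_ge0 ?exprn_ge0//; lra.
have bT : b * T <= n * T by rewrite ler_wpM2r.
(* The margin [r / 2] in the hypothesis keeps the upward drift [n (K - 1)] below the downward drift
   [r K] by at least [r / 2], so the coefficient of [v ^+ 2] is at most [- 3 / 2 * r]. *)
have hm1 : n * (K - 1) <= r * (K - 1 / 2).
  have h : (K - 1) * (n - r) <= r / 2.
    have [nr|nr] := leP n r; first by nra.
    by apply: le_trans hm; rewrite ler_wpM2r//; lra.
  lra.
have hm2 : n <= 3 / 2 * r by nra.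
have e1 : n * (K - 1) * v ^+ 2 <= r * (K - 1 / 2) * v ^+ 2.
  by rewrite ler_wpM2r// sqr_ge0.
have KK : 0 <= (K - 1) ^+ 2 <= K ^+ 2.
  by rewrite sqr_ge0/= lerXn2r ?nnegrE; lra.
have KKK : 0 <= (K - 1) ^+ 3 <= K ^+ 4.
  apply/andP; split; first by rewrite exprn_ge0; lra.
  apply: (@le_trans _ _ (K ^+ 3)); first by rewrite lerXn2r ?nnegrE; lra.
  by rewrite ler_weXn2l.
have e2 : n * ((K - 1) ^+ 2 * v) <= 3 / 2 * r * (K ^+ 2 * v).
  have /andP[q0 q1] := KK.
  apply: (@le_trans _ _ (3 / 2 * r * ((K - 1) ^+ 2 * v))).
    by rewrite ler_wpM2r// mulr_ge0.
  by rewrite ler_pM2l ?mulr_gt0// ler_wpM2r.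
have e3 : n * (K - 1) ^+ 3 <= 3 / 2 * r * K ^+ 4.
  have /andP[q0 q1] := KKK.
  apply: (@le_trans _ _ (3 / 2 * r * (K - 1) ^+ 3)).
    by rewrite ler_wpM2r.
  by rewrite ler_pM2l ?mulr_gt0.
have e4 : 0 <= r * (v - 15 / 2 * K ^+ 2) ^+ 2 by rewrite mulr_ge0 ?sqr_ge0// ltW.
have e5 : 0 <= r * K ^+ 4 by rewrite mulr_ge0 ?exprn_ge0//; lra.
apply: le_trans (lerD (lexx _) bT) _; rewrite /T.
lra.
Qed.

(** With [X] the last factor, either [X >= k y^2 / 2] (for [y > 0], or [z] above the linear target)
    or [X >= f |y|] ([z] at the cap). The two coefficients serve these two cases; [d] is left free
    to be optimized later. *)
Lemma absz_le_overshoot (s : state) (d : R) : gbs_inv s -> 0 < d ->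
  `|s.1%:~R| <= d + (2 / (k%:R * d) + f^-1)
     * (- (s.2%:R - r / beta) * s.1%:~R
        + (2 * (overshoot s)%:~R ^+ 2 + 2) / (2 * k%:R)).
Proof.
case: s => y z [/= h1 h2 h3] d0; set v : R := (overshoot _)%:~R.
have k0 : 0 < k%:R :> R by rewrite ltr0n.
set c1 := 2 / (k%:R * d); set c2 := f^-1.
have c1k : c1 * k%:R = 2 / d by rewrite /c1; field; rewrite ?gt_eqF.
have c10 : 0 < c1 by rewrite divr_gt0 ?mulr_gt0.
have c20 : 0 < c2 by rewrite invr_gt0.
set X : R := (X in _ <= _ + _ * X).
have vE : 0 <= (2 * v ^+ 2 + 2) / (2 * k%:R).
  by rewrite divr_ge0 ?mulr_ge0 ?(ltW k0)// addr_ge0// mulr_ge0// sqr_ge0.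
(* Here [c1 * X >= w ^+ 2 / d], and [w <= d + w ^+ 2 / d]. *)
have quad : forall w : R, `|y%:~R| = w -> k%:R / 2 * w ^+ 2 <= X ->
    `|y%:~R| <= d + (c1 + c2) * X.
  move=> w -> hX.
  have X0 : 0 <= X by apply: le_trans hX; rewrite mulr_ge0 ?sqr_ge0// divr_ge0// ltW.
  have : c1 * (k%:R / 2 * w ^+ 2) <= c1 * X by rewrite ler_pM2l.
  rewrite mulrA (mulrA c1) c1k => hc1.
  have : 0 <= c2 * X by rewrite mulr_ge0// ltW.
  rewrite mulrDl => hc2.
  have : 0 <= (w - d / 2) ^+ 2 / d + d / 4 * 3.
    by rewrite addr_ge0 ?divr_ge0 ?sqr_ge0 ?(ltW d0)// mulr_ge0// divr_ge0// ltW.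
  have -> : (w - d / 2) ^+ 2 / d = 2 / d / 2 * w ^+ 2 - w + d / 4.
    by field; rewrite gt_eqF.
  move=> hw; lra.
have Aa : r / beta <= A%:~R by exact: ceil_ge.
have Aa1 : A%:~R < r / beta + 1.
  by have := ceilB1_lt (r / beta); rewrite -/A intrB ltrBlDr.
have [y0|y0] := boolP (0 < y).
- have yR : 0 < y%:~R :> R by rewrite ltr0z.
  apply: (quad y%:~R); first by rewrite gtr0_norm.
  have hv : z%:R + k%:R * y%:~R - A%:~R <= v.
    rewrite -[z%:R]/(z%:Z%:~R) -[k%:R]/(k%:Z%:~R) -intrM -intrD -intrB ler_int.
    by rewrite /overshoot /= le_max lexx.
  (* The 1 added to [v] pays for rounding [r / beta] up to [A]. *)
  have e : (k%:R * y%:~R - (v + 1)) * y%:~R <= - (z%:R - r / beta) * y%:~R.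
    by rewrite ler_pM2r//; lra.
  (* The numerator comes from [(v + 1) ^+ 2 + (v - 1) ^+ 2 = 2 * v ^+ 2 + 2], which removes the
     cross term in [v]. *)
  have sq : (v + 1) * y%:~R <= k%:R / 2 * y%:~R ^+ 2 + (2 * v ^+ 2 + 2) / (2 * k%:R).
    have : 0 <= ((k%:R * y%:~R - (v + 1)) ^+ 2 + (v - 1) ^+ 2) / (2 * k%:R).
      by rewrite divr_ge0 ?addr_ge0 ?sqr_ge0// mulr_ge0// ltW.
    have -> : ((k%:R * y%:~R - (v + 1)) ^+ 2 + (v - 1) ^+ 2) / (2 * k%:R)
      = k%:R / 2 * y%:~R ^+ 2 + (2 * v ^+ 2 + 2) / (2 * k%:R) - (v + 1) * y%:~R.
      by field; rewrite gt_eqF.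
    lra.
  rewrite /X; lra.
- have yR : y%:~R <= 0 :> R by rewrite lerz0 leNgt.
  have Mf : r / beta + f <= M%:~R by exact: ceil_ge.
  have hz : A - k%:Z * y <= z%:Z \/ M <= z%:Z.
    move: h1; rewrite /gbs_level; move: (A - _) (M) => u n; clear; lia.
  case: hz => hz.
    apply: (quad (- y%:~R)); first by rewrite ler0_norm.
    have hz' : A%:~R - k%:R * y%:~R <= z%:R :> R.
      by rewrite -[z%:R]/(z%:Z%:~R) -[k%:R]/(k%:Z%:~R) -intrM -intrB ler_int.
    have : - k%:R * y%:~R * - y%:~R <= (z%:R - r / beta) * - y%:~R.
      by rewrite ler_wpM2r ?oppr_ge0//; lra.
    have : 0 <= k%:R * y%:~R ^+ 2 :> R by rewrite mulr_ge0 ?(ltW k0)// sqr_ge0.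
    rewrite /X; lra.
  rewrite ler0_norm//.
  have hz' : M%:~R <= z%:R :> R by rewrite -[z%:R]/(z%:Z%:~R) ler_int.
  have hX : f * - y%:~R <= X.
    have : f * - y%:~R <= (z%:R - r / beta) * - y%:~R.
      by rewrite ler_wpM2r ?oppr_ge0//; lra.
    rewrite /X; lra.
  have : c2 * (f * - y%:~R) <= c2 * X by rewrite ler_pM2l.
  rewrite mulrA mulVf ?gt_eqF// mul1r => h.
  have : 0 <= c1 * X.
    rewrite mulr_ge0 ?(ltW c10)// (le_trans _ hX)//.
    by rewrite mulr_ge0 ?(ltW f_gt0)// oppr_ge0.
  rewrite mulrDl; lra.
Qed.

(** The flow identity is tested on [v ^+ 3], [Y] and [Y ^+ 2]. Working on a finite truncation avoids
    integrability questions, and the bound is uniform in [j]. *)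
Lemma gbs_truncated_abs_le (F : seq state) (p : state -> R) (j : nat) (d : R) :
  (forall s, s \in F -> gbs_inv s) -> (forall s, 0 <= p s) ->
  \sum_(s <- F) p s <= 1 ->
  (forall g : state -> R, \sum_(s <- F) p s * L g s
          = p (tail j) * r * (g (tail j.+1) - g (tail j))) ->
  k%:R * (m - r) <= r / 2 -> k%:R ^+ 3 <= r / beta -> 0 < d ->
  \sum_(s <- F) p s * `|s.1%:~R|
    <= d + 32 * (2 / (k%:R * d) + f^-1) * (r / beta).
Proof.
move=> FI p0 p1 flow small_cap kr d0.
have k0 : 0 < k%:R :> R by rewrite ltr0n.
pose v s : R := (overshoot s)%:~R.
pose mu (g : state -> R) : R := \sum_(s <- F) p s * g s.
have muM (g h : state -> R) : (forall s, s \in F -> g s <= h s) -> mu g <= mu h.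
  move=> gh; rewrite /mu big_seq [leRHS]big_seq; apply: ler_sum => s sF.
  by rewrite ler_wpM2l// gh.
have muD g h : mu (fun s => g s + h s) = mu g + mu h.
  by rewrite /mu -big_split; apply: eq_bigr => s _; rewrite mulrDr.
have muZ c g : mu (fun s => c * g s) = c * mu g.
  by rewrite /mu mulr_sumr; apply: eq_bigr => s _; rewrite mulrCA.
pose w := mu (fun=> 1).
have w1 : w <= 1 by rewrite /w /mu; under eq_bigr do rewrite mulr1.
have v2 : mu (fun s => v s ^+ 2) <= 30 * k%:R ^+ 4.
  have h : mu (L (fun s => v s ^+ 3))
      <= mu (fun s => r * (30 * k%:R ^+ 4 * 1 + - 1 * v s ^+ 2)).
    apply: muM => s /FI sI; rewrite mulr1 mulN1r.
    exact: generator_overshoot_cube.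
  (* No boundary term: the overshoot vanishes on the tail. *)
  have h0 : mu (L (fun s => v s ^+ 3)) = 0.
    by rewrite /mu flow /v !overshoot_tail subrr mulr0.
  rewrite h0 muZ pmulr_rge0// muD !muZ -/w mulN1r subr_ge0 in h.
  apply: le_trans h _; rewrite -[leRHS]mulr1 ler_wpM2l// mulr_ge0// exprn_ge0// ltW.
pose u (s : state) : R := s.2%:R - r / beta.
have betaN : beta != 0 by rewrite gt_eqF.
pose Y (s : state) : R := s.1%:~R.
have f1 : mu (fun s => beta * u s) = - (p (tail j) * r).
  transitivity (mu (L Y)).
    apply: eq_bigr => s _; congr (_ * _).
    by rewrite /L /generator /Y /u /= intrB intrD; field.
  by rewrite /mu flow /Y /= -/M !intrN !intrD -[j.+1%:~R]/(j.+1%:R) -natr1; ring.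
have f2 : mu (fun s => 2 * beta * (u s * Y s) + (2 * r * 1 + beta * u s))
    = p (tail j) * r * (2 * (M%:~R + j%:R) + 1).
  transitivity (mu (L (fun s => Y s ^+ 2))).
    apply: eq_bigr => s _; congr (_ * _).
    by rewrite /L /generator /Y /u /= intrB intrD; field.
  by rewrite /mu flow /Y /= -/M !intrN !intrD -[j.+1%:~R]/(j.+1%:R) -natr1; ring.
(* Both boundary terms, from [Y] and from [Y ^+ 2], have the favourable sign and are discarded. *)
have uY : mu (fun s => - 1 * (u s * Y s)) <= r / beta.
  rewrite ler_pdivlMr// muZ.
  move: f2; rewrite !muD f1 !muZ -/w => f2.
  have pr : 0 <= p (tail j) * r by rewrite mulr_ge0// ltW.
  have : 0 <= p (tail j) * r * (2 * (M%:~R + j%:R) + 1).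
    by rewrite mulr_ge0// addr_ge0// mulr_ge0// addr_ge0// ler0z ltW.
  rewrite -f2 => f3.
  have : r * w <= r * 1 by rewrite ler_pM2l.
  move: f3; lra.
set c := 2 / (k%:R * d) + f^-1.
have c0 : 0 <= c by rewrite addr_ge0 ?invr_ge0 ?divr_ge0 ?mulr_ge0 ?(ltW f_gt0) ?(ltW d0).
have h : mu (fun s => `|Y s|) <= mu (fun s => d * 1 + c * (- 1 * (u s * Y s)
           + (k%:R^-1 * v s ^+ 2 + k%:R^-1 * 1))).
  apply: muM => s /FI sI.
  have -> : d * 1 + c * (- 1 * (u s * Y s) + (k%:R^-1 * v s ^+ 2 + k%:R^-1 * 1))
     = d + c * (- (s.2%:R - r / beta) * s.1%:~R + (2 * v s ^+ 2 + 2) / (2 * k%:R)).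
    by rewrite /u /Y; field; rewrite ?gt_eqF.
  exact: absz_le_overshoot.
apply: le_trans h _; rewrite muD !muZ muD muD !muZ -/w.
have e1 : d * w <= d * 1 by rewrite ler_pM2l.
have e2 : k%:R^-1 * mu (fun s => v s ^+ 2) <= 30 * k%:R ^+ 3.
  rewrite mulrC ler_pdivrMr// (le_trans v2)//.
  by rewrite le_eqVlt; apply/orP; left; apply/eqP; ring.
have e3 : k%:R^-1 * w <= k%:R ^+ 3.
  apply: (@le_trans _ _ 1); last by rewrite exprn_ege1.
  by rewrite mulrC ler_pdivrMr// mul1r (le_trans w1).
(* [32 = 1 + 30 + 1]: the bound [uY], then [e2] and [e3], where [k ^+ 3 <= r / beta]. *)
have e4 : c * (- 1 * mu (fun s => u s * Y s) + (k%:R^-1 * mu (fun s => v s ^+ 2)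
    + k%:R^-1 * w)) <= c * (32 * (r / beta)).
  rewrite ler_wpM2l//.
  by move: uY; rewrite muZ => uY; lra.
lra.
Qed.

(** Global balance at [s] is the flow identity for the indicator of [s], truncated far enough below
    [s] that the boundary term is 0. The geometric remainder gives total mass 1. *)
Lemma gbs_stationary_of_flow (F : nat -> seq state) (p : state -> R) (c rho : R) :
  (forall j, uniq (F j)) ->
  (forall j (s : state), (s \in F j) <-> (E s /\ - (M + j%:Z) <= s.1)) ->
  (forall s, 0 <= p s) -> (forall s, ~ E s -> p s = 0) ->
  0 <= c -> 0 <= rho < 1 ->
  (forall j, \sum_(s <- F j) p s = 1 - c * rho ^+ j) ->
  (forall j (g : state -> R), \sum_(s <- F j) p s * L g s
          = p (tail j) * r * (g (tail j.+1) - g (tail j))) ->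
  gbs_stationary beta r k%:R f 0 p
  /\ forall B : R, (forall j, \sum_(s <- F j) p s * `|s.1%:~R| <= B) ->
       (mean_abs_inventory p <= B%:E)%E.
Proof.
move=> uF FP p0 pE c0 /andP[rho0 rho1] sump flow.
have subF i j : (i <= j)%N -> {subset F i <= F j}.
  by move=> ij s /FP[Es si]; apply/FP; split=> //; lia.
have pF (s : state) : p s != 0 -> E s.
  by move=> ps; apply: contrapT => /pE ps0; rewrite ps0 eqxx in ps.
have exF (h : state -> R) : (forall s, p s = 0 -> h s = 0) ->
    forall s, h s != 0 -> exists j, s \in F j.
  move=> ph s hs; exists `|s.1|%N; apply/FP; split; last by lia.
  by apply: pF; apply: contra hs => /eqP/ph ->.
split; last first.
  move=> B hB; rewrite /mean_abs_inventory /mean (esum_sup_seq _ _ F)//.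
  - by apply: ub_ereal_sup => _ [j _ <-]; rewrite lee_fin.
  - by move=> s; rewrite mulr_ge0.
  - by apply: exF => s ->; rewrite mul0r.
have q0 s t : 0 <= q s t.
  rewrite /q /rate addr_ge0// mulrn_wge0 ?mulr_ge0//; exact: ltW.
split => //.
- rewrite (esum_sup_seq _ _ F)//; last exact: exF.
  apply/eqP; rewrite eq_le; apply/andP; split.
    apply: ub_ereal_sup => _ [j _ <-]; rewrite lee_fin sump.
    by rewrite gerBl mulr_ge0// exprn_ge0.
  apply/lee_addgt0Pr => e e0.
  have : (fun j => c * rho ^+ j) @ \oo --> (0 : R).
    by rewrite -(mulr0 c); apply: cvgMr; apply: cvg_expr; rewrite ger0_norm.
  move=> /cvgr0Pnorm_lt /(_ _ e0) [j _ /(_ j (leqnn j)) /= hj].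
  apply: (@le_trans _ _ ((1 - c * rho ^+ j)%:E + e%:E)%E).
    rewrite -EFinD lee_fin.
    by move: hj; rewrite ger0_norm ?mulr_ge0 ?exprn_ge0// => hj; lra.
  by rewrite leeD2r//; apply: ereal_sup_ubound; exists j => //; rewrite sump.
(* The offset 2 puts the cut below [s] and all its possible predecessors, so that neither [tail j]
   nor [tail j.+1] is [s]. *)
- move=> s; change state in (type of s); pose j := `|s.1|%N.+2.
  have [sj1 sj2] : tail j != s /\ tail j.+1 != s.
    by split; apply/eqP => /(congr1 fst) /=; rewrite -/M /j; lia.
  rewrite esum_rate_out// ?(ltW beta_gt0) ?(ltW r_gt0)//.
  rewrite (esum_seq _ _ (F j))//; last 2 first.
  + by move=> t; rewrite mulr_ge0.
  + move=> t; change state in (type of t); move=> tF.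
    have [->|pt] := eqVneq (p t) 0; first by rewrite mul0r.
    rewrite /q /rate.
    have tj : (t : state).1 < - (M + j%:Z).
      rewrite ltNge; apply: contra tF => tj; apply/FP; split=> //; exact: pF.
    have -> : (s == after_customer P t) = false.
      by apply/eqP => /(congr1 fst) /= sE; move: tj M0; rewrite /j sE; clear; lia.
    have -> : (s == after_item P t) = false.
      by apply/eqP => /(congr1 fst) /= sE; move: tj M0; rewrite /j sE; clear; lia.
    by rewrite !mulr0n addr0 mulr0.
  have := flow j (fun t => (t == s)%:R).
  rewrite (negPf sj1) (negPf sj2) subrr mulr0 => fl.
  have : \sum_(t <- F j) p t * q t s
      = \sum_(t <- F j) (1 *+ (t == s)) * (p t * (r + beta * t.2%:R)).
    rewrite -[RHS]addr0 -[X in _ = _ + X]fl -big_split; apply: eq_bigr => t _.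
    rewrite /= /L /generator /q /rate -/P !(eq_sym s) !(mulrb r) !(mulrb (_ * _)).
    by do 3![case: eqP => _ /=]; ring.
  move=> ->; rewrite sum_seq_delta// mul1r; case: (boolP (s \in F j)) => //= sF.
  rewrite mulr0n (_ : p s = 0) ?mul0r//; apply/eqP; apply: contraNT sF => ps.
  by apply/FP; split; [exact: pF | rewrite /j; move: M0; clear; lia].
Qed.

Lemma gbs_stationary_exists : exists p : state -> R,
  gbs_stationary beta r k%:R f 0 p /\
  forall d : R, k%:R * (beta * M%:~R - r) <= r / 2 -> k%:R ^+ 3 <= r / beta ->
    0 < d -> (mean_abs_inventory p
               <= (d + 32 * (2 / (k%:R * d) + f^-1) * (r / beta))%:E)%E.
Proof.
have [F [p [c [rho [uF FP p0 pE [c0 rho01 sump flow]]]]]] := gbs_flow.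
have [st bd] := gbs_stationary_of_flow F p c rho uF FP p0 pE c0 rho01 sump flow.
exists p; split=> // d small kr d0; apply: bd => j.
apply: (gbs_truncated_abs_le (F j) p j d) => //.
- by move=> s /FP[Es _]; exact: gbs_states_inv.
- rewrite sump gerBl mulr_ge0// exprn_ge0//; by case/andP: rho01.
Qed.

End GBSChain.

(** * Anti-concentration under CBS *)

Section CBS.
Context {R : realType} (beta r : R) (X : int) (p : state -> R).
Hypotheses (beta_gt0 : 0 < beta) (r_gt0 : 0 < r).
Hypothesis p_cbs : cbs_stationary beta r X p.

Let pz (z : nat) : R := p (X - z%:Z, z).

Lemma cbs_global_balance (z : nat) :
  pz z * (r + beta * z%:R)
    = pz z.+1 * (beta * z.+1%:R) + (if z is y.+1 then pz y * r else 0).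
Proof.
have [p0 pE _ bal] := p_cbs.
have /= := bal (X - z%:Z, z); rewrite esum_rate_out ?(ltW beta_gt0) ?(ltW r_gt0)//=.
pose F : seq state := (X - z.+1%:Z, z.+1) :: if z is y.+1 then [:: (X - y%:Z, y)] else [::].
rewrite (esum_seq _ _ F); first last.
- move=> [y w] yw; have [yX|/eqP yX] := eqVneq (y + w%:Z) X; last by rewrite pE ?mul0r.
  rewrite /rate /after_customer /after_item /= addn1 addn0.
  have -> : ((X - z%:Z, z) == (y - 1, w.+1)) = false.
    apply/eqP => -[e1 e2]; move: yw; rewrite /F e2 !inE => /norP[_ /eqP]; apply.
    by congr (_, _); lia.
  case: w yX yw => [|w] yX yw; first by rewrite mulr0 mul0rn addr0 mulr0.
  have -> : ((X - z%:Z, z) == (y + 1, w.+1.-1)) = false.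
    apply/eqP => -[e1 e2]; move: yw; rewrite /F e2 !inE => /norP[/eqP + _]; apply.
    by congr (_, _); lia.
  by rewrite addr0 mulr0.
- move=> t; rewrite mulr_ge0 ?p0// /rate addr_ge0// mulrn_wge0 ?mulr_ge0//; exact: ltW.
- by rewrite /F; case: z F => //= z _; rewrite andbT inE; apply/eqP => -[]; lia.
move=> [->]; rewrite /F /rate /after_customer /after_item big_cons /=; congr (_ + _).
  rewrite addn0 (_ : (_ == _) = false); last by apply/eqP => -[]; lia.
  rewrite (_ : (_ == _) = true) ?add0r//; apply/eqP; congr (_, _); lia.
case: z F => [|z] _; rewrite ?big_nil// big_seq1 /= addn1.
rewrite (_ : (_ == _) = true); last by apply/eqP; congr (_, _); lia.
rewrite (_ : (_ == _) = false) ?addr0//; apply/eqP => -[]; lia.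
Qed.

(** Summing global balance over [0, ..., z] leaves only the flow across the cut between [z] and
    [z.+1]. This is the Poisson recursion with mean [r / beta]. *)
Lemma cbs_cut (z : nat) : pz z.+1 * z.+1%:R = pz z * (r / beta).
Proof.
have b0 : beta != 0 by rewrite gt_eqF.
apply: (mulfI b0); elim: z => [|z ih].
  have := cbs_global_balance 0; rewrite mulr0 !addr0 => h.
  have -> : beta * (pz 0 * (r / beta)) = pz 0 * r by field.
  by rewrite h; ring.
have := cbs_global_balance z.+1 => h.
have : beta * (pz z * (r / beta)) = pz z * r by field.
rewrite -ih => ih'.
have -> : beta * (pz z.+1 * (r / beta)) = pz z.+1 * r by field.
by rewrite -ih' in h; lra.
Qed.

Let pz0 (z : nat) : 0 <= pz z.
Proof. by case: p_cbs => p0 _ _ _; exact: p0. Qed.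

Lemma cbs_sum_le1 (F : seq nat) : uniq F -> \sum_(z <- F) pz z <= 1.
Proof.
move=> uF; case: p_cbs => _ _ p1 _; rewrite -lee_fin -p1.
have := @sum_le_esum _ _ [seq ((X - z%:Z, z) : state) | z <- F] p.
rewrite big_map; apply; rewrite map_inj_uniq// => z w; by case.
Qed.

(* The weights vary by a factor of at most 2 over [m <= sqrt (r / (2 beta))]
   consecutive sites, on the side of [z] facing the mode. *)
Lemma cbs_pmf_le (m z : nat) : 2 * m%:R ^+ 2 <= r / beta -> pz z <= 2 / m.+1%:R.
Proof.
set a := r / beta => ma.
have a0 : 0 < a by rewrite divr_gt0.
have m_a : m%:R <= a :> R.
  case: m ma => [|m] ma; first by rewrite ltW.
  apply: le_trans ma; have : 1 <= m.+1%:R :> R by rewrite ler1n.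
  nra.
have ma2 : m%:R * m%:R / a <= 1 / 2 :> R.
  by rewrite ler_pdivrMr//; lra.
(* [g] walks from [z] towards the mean. Each of the first [m] steps keeps a factor at least
   [1 - m / a], and by Bernoulli [j] steps keep [1 - j m / a >= 1 / 2]; the [m.+1] weights sum to at
   most 1. *)
suff [g gi gp] : exists2 g : nat -> nat, {in [pred j | (j <= m)%N] &, injective g} &
    forall j, (j <= m)%N -> pz z * (1 - j%:R * (m%:R / a)) <= pz (g j).
  have := cbs_sum_le1 [seq g j | j <- iota 0 m.+1].
  rewrite map_inj_in_uniq ?iota_uniq; last first.
    by move=> i j; rewrite !mem_iota => hi hj; apply: gi; rewrite inE; lia.
  move=> /(_ isT); rewrite big_map => h; rewrite ler_pdivlMr ?ltr0n//.
  have : \sum_(j <- iota 0 m.+1) pz z / 2 <= \sum_(j <- iota 0 m.+1) pz (g j).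
    rewrite big_seq [leRHS]big_seq; apply: ler_sum => j; rewrite mem_iota => hj.
    have jm : (j <= m)%N by lia.
    apply: le_trans (gp _ jm); rewrite ler_wpM2l//.
    have jmR : j%:R <= m%:R :> R by rewrite ler_nat.
    have : j%:R * (m%:R / a) <= m%:R * (m%:R / a).
      by rewrite ler_wpM2r// divr_ge0// ltW.
    rewrite mulrA; move: ma2; lra.
  rewrite big_const_seq count_predT size_iota iter_addr_0 -mulr_natr; lra.
have t0 : 0 <= m%:R / a by rewrite divr_ge0// ltW.
have step j (x y : R) : (j < m)%N -> 0 <= x -> pz z * (1 - j%:R * (m%:R / a)) <= x ->
    x * (1 - m%:R / a) <= y -> pz z * (1 - j.+1%:R * (m%:R / a)) <= y.
  move=> jm x0 hx; apply: le_trans.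
  have t1 : 0 <= 1 - m%:R / a by rewrite subr_ge0 ler_pdivrMr// mul1r.
  apply: le_trans (ler_wpM2r t1 hx).
  rewrite -mulrA ler_wpM2l// -natr1.
  have : 0 <= j%:R * (m%:R / a) * (m%:R / a) by rewrite mulr_ge0// mulr_ge0.
  lra.
have [za|za] := leP z%:R a.
- exists (fun j => (z + j)%N) => [i j _ _ /addnI//|].
  elim=> [|j ih] jm; first by rewrite mul0r subr0 mulr1 addn0.
  apply: (step _ _ _ jm (pz0 (z + j)) (ih (ltnW jm))).
  rewrite addnS; have := cbs_cut (z + j); rewrite -/a => h.
  rewrite -(ler_pM2r (x := (z + j).+1%:R)) ?ltr0n// h -mulrA ler_wpM2l//.
  have hz : (z + j).+1%:R <= a + m%:R :> R.
    rewrite -addnS natrD lerD// ler_nat//.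
  have t1 : 0 <= 1 - m%:R / a by rewrite subr_ge0 ler_pdivrMr// mul1r.
  apply: le_trans (ler_wpM2l t1 hz) _.
  have -> : (1 - m%:R / a) * (a + m%:R) = a - m%:R ^+ 2 / a by field; rewrite gt_eqF.
  by rewrite gerBl divr_ge0 ?sqr_ge0// ltW.
(* This keeps the natural-number subtraction [z - j] exact, hence injective. *)
- have mz : (m <= z)%N by rewrite -(ler_nat R) (le_trans m_a)// ltW.
  exists (fun j => (z - j)%N) => [i j|]; first by rewrite !inE; lia.
  elim=> [|j ih] jm; first by rewrite mul0r subr0 mulr1 subn0.
  apply: (step _ _ _ jm (pz0 (z - j)) (ih (ltnW jm))).
  have := cbs_cut (z - j.+1); have -> : (z - j.+1).+1 = (z - j)%N by lia.
  rewrite -/a => h.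
  rewrite -(ler_pM2r a0) -h -mulrA ler_wpM2l// natrB; last by lia.
  have : j%:R <= m%:R :> R by rewrite ler_nat ltnW.
  have -> : (1 - m%:R / a) * a = a - m%:R by field; rewrite gt_eqF.
  lra.
Qed.

(** At most [2 n] states satisfy [|y| < n], each of weight at most [2 / m.+1], so their mass is at
    most 1/2 when [8 n <= m.+1], wherever [X] lies. *)
Lemma cbs_mean_abs_ge (m n : nat) : 2 * m%:R ^+ 2 <= r / beta -> (8 * n <= m.+1)%N ->
  ((n%:R / 2)%:E <= mean_abs_inventory p)%E.
Proof.
move=> ma nm; have [p0 pE p1 _] := p_cbs.
pose near (s : state) := (`|s.1| < n)%N.
pose F : seq state := undup [seq (i%:Z - n%:Z, `|(X - (i%:Z - n%:Z))%R|%N) | i <- iota 0 (2 * n)].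
have pF s : p s <= 2 / m.+1%:R.
  have [sX|/eqP sX] := eqVneq (s.1 + s.2%:Z) X; last by rewrite pE// divr_ge0.
  have := cbs_pmf_le m s.2 ma; rewrite /pz -sX addrK.
  by case: (s).
have c0 s : 0 <= n%:R * p s *+ near s by rewrite mulrn_wge0// mulr_ge0.
have hF : (\esum_(s in setT) (n%:R * p s *+ near s)%:E <= (n%:R / 2)%:E)%E.
  rewrite (esum_seq _ _ F) ?undup_uniq//; last first.
    move=> [y z] /= yzF; have [yX|/eqP yX] := eqVneq (y + z%:Z) X; last first.
      by rewrite pE// mulr0 mul0rn.
    rewrite /near /= (_ : (_ < _)%N = false) ?mulr0n//; apply/negP => yn.
    move: yzF; rewrite mem_undup => /mapP; apply.
    exists `|(y + n%:Z)%R|%N; first by rewrite mem_iota; lia.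
    by congr (_, _); lia.
  rewrite lee_fin; apply: (@le_trans _ _ (\sum_(s <- F) n%:R * (2 / m.+1%:R))).
    apply: ler_sum => s _; apply: (@le_trans _ _ (n%:R * p s)); last by rewrite ler_wpM2l.
    by case: (near s); rewrite ?mulr0n ?mulr_ge0.
  rewrite big_const_seq count_predT iter_addr_0 -[leLHS]mulr_natr.
  have : (size F)%:R <= (2 * n)%:R :> R.
    by rewrite ler_nat (leq_trans (size_undup _))// size_map size_iota.
  have : (8 * n)%:R <= m.+1%:R :> R by rewrite ler_nat.
  rewrite !natrM => h8 hs.
  have m0 : 0 < m.+1%:R :> R by rewrite ltr0n.
  have n0 : 0 <= n%:R :> R by [].
  apply: (@le_trans _ _ (n%:R * (2 / m.+1%:R) * (2 * n%:R))).
    by rewrite ler_wpM2l// mulr_ge0// divr_ge0.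
  have -> : n%:R * (2 / m.+1%:R) * (2 * n%:R) = n%:R * (4 * n%:R) / m.+1%:R :> R.
    by ring.
  rewrite ler_pdivrMr//.
  have : n%:R * (8 * n%:R) <= n%:R * m.+1%:R :> R by rewrite ler_wpM2l.
  lra.
(* Markov's inequality in additive form: [n <= |y| + n] times the indicator of [|y| < n]. *)
have : (n%:R%:E <= mean_abs_inventory p + (n%:R / 2)%:E :> \bar R)%E.
  apply: le_trans (leeD2l _ hF).
  rewrite /mean_abs_inventory /mean -esumD; last 2 first.
  - by move=> s _; rewrite lee_fin mulr_ge0.
  - by move=> s _; rewrite lee_fin.
  have -> : n%:R%:E = \esum_(s in setT) (n%:R * p s)%:E.
    elim: {nm near F c0 hF} n => [|n ih].
      by rewrite esum1// => s _; rewrite mul0r.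
    rewrite -natr1 EFinD ih -p1 -esumD; last 2 first.
    - by move=> s _; rewrite lee_fin mulr_ge0.
    - by move=> s _; rewrite lee_fin.
    by apply: eq_esum => s _; rewrite -EFinD mulrDl mul1r.
  apply: le_esum => s _; rewrite -EFinD lee_fin /near.
  have [sn|ns] := ltnP `|s.1|%N n; first by rewrite mulr1n lerDr mulr_ge0.
  rewrite mulr0n addr0 mulrC ler_wpM2l//.
  by rewrite -intr_norm -[n%:R]/(n%:Z%:~R) ler_int; lia.
case: (mean_abs_inventory p) => [x| |]; rewrite ?leey//.
by rewrite -EFinD !lee_fin; lra.
Qed.
End CBS.

(** * Extended-real limits and comparison of the cost with the mean absolute inventory *)

Lemma cvge0P (R : realType) (u : nat -> \bar R) : (forall n, 0 <= u n)%E ->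
  (u n @[n --> \oo] --> (0 : \bar R))
  <-> (forall e : R, 0 < e -> \forall n \near \oo, (u n <= e%:E)%E).
Proof.
move=> u0; split.
  move=> /fine_cvgP[fu /cvgr0Pnorm_le cu] e e0.
  near=> n; have un : u n \is a fin_num by near: n.
  rewrite -(fineK un) lee_fin (le_trans (ler_norm _))//.
  by near: n; exact: cu.
move=> hu; apply/fine_cvgP.
have fu : \forall n \near \oo, u n \is a fin_num.
  have := hu 1 ltr01; apply: filterS => n un.
  by rewrite ge0_fin_numE// (le_lt_trans un)// ltry.
split => //; apply/cvgr0Pnorm_le => e e0.
near=> n; have un : u n \is a fin_num by near: n.
rewrite /= ger0_norm ?fine_ge0// -lee_fin fineK//.
by near: n; exact: hu.
Unshelve. all: by end_near. Qed.

Section Cost.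
Context {R : realType} (h theta : R) (p : state -> R).
Hypotheses (h_gt0 : 0 < h) (theta_gt0 : 0 < theta) (p0 : forall s, 0 <= p s).

Let pos := mean p (fun s => Num.max s.1%:~R 0).
Let neg := mean p (fun s => Num.max (- s.1%:~R) 0).

Let pos0 : (0 <= pos)%E.
Proof. by apply: esum_ge0 => s _; rewrite lee_fin mulr_ge0// le_max lexx orbT. Qed.

Let neg0 : (0 <= neg)%E.
Proof. by apply: esum_ge0 => s _; rewrite lee_fin mulr_ge0// le_max lexx orbT. Qed.

Lemma mean_abs_inventoryE : mean_abs_inventory p = (pos + neg)%E.
Proof.
rewrite /pos /neg /mean_abs_inventory /mean -esumD; last 2 first.
- by move=> s _; rewrite lee_fin mulr_ge0// le_max lexx orbT.
- by move=> s _; rewrite lee_fin mulr_ge0// le_max lexx orbT.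
apply: eq_esum => s _; rewrite -EFinD -mulrDr; congr (p s * _)%:E.
case: (leP 0 (s.1%:~R : R)) => s0.
  by rewrite ger0_norm// max_r ?addr0// oppr_le0.
by rewrite ltr0_norm// max_l ?add0r// oppr_ge0 ltW.
Qed.

Lemma cost_ge0 : (0 <= cost h theta p)%E.
Proof. by rewrite adde_ge0// mule_ge0// lee_fin ltW. Qed.

Lemma cost_le : (cost h theta p <= (h + theta)%:E * mean_abs_inventory p)%E.
Proof.
rewrite mean_abs_inventoryE ge0_muleDr// leeD// lee_wpmul2r// lee_fin.
  by rewrite lerDl ltW.
by rewrite lerDr ltW.
Qed.

Lemma cost_ge : ((Num.min h theta)%:E * mean_abs_inventory p <= cost h theta p)%E.
Proof.
rewrite mean_abs_inventoryE ge0_muleDr// leeD// lee_wpmul2r// lee_fin.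
  by rewrite ge_min lexx.
by rewrite ge_min lexx orbT.
Qed.

End Cost.

(** * The square-root lower bound and the choice of the gain *)

Lemma mean_abs_inventory_ge0 (R : realType) (p : state -> R) :
  (forall s, 0 <= p s) -> (0 <= mean_abs_inventory p)%E.
Proof. by move=> p0; apply: esum_ge0 => s _; rewrite lee_fin mulr_ge0. Qed.

(** Take [m] the integer part of [sqrt (r / (2 beta))] and [n] that of [m.+1 / 8]. The condition on
    [r] makes the square root at least 16, enough to absorb the rounding into the constant 32. *)
Lemma cbs_mean_abs_sqrt (R : realType) (beta r : R) (X : int) (p : state -> R) :
  0 < beta -> 512 * beta <= r -> cbs_stationary beta r X p ->
  ((Num.sqrt (r / (2 * beta)) / 32)%:E <= mean_abs_inventory p)%E.
Proof.
move=> beta0 r512 pC; have c512 : 0 < 512 :> R by rewrite ltr0n.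
have r0 : 0 < r := lt_le_trans (mulr_gt0 c512 beta0) r512; clear c512.
set x := r / (2 * beta); set m := Num.truncn (Num.sqrt x).
have x0 : 0 <= x by rewrite divr_ge0 ?(ltW r0)// mulr_ge0// ltW.
have mx : m%:R <= Num.sqrt x by rewrite truncn_le sqrtr_ge0.
have xm : Num.sqrt x < m.+1%:R by exact: truncnS_gt.
have x16 : 16 <= Num.sqrt x.
  have <- : Num.sqrt (16 ^+ 2) = 16 :> R by rewrite sqrtr_sqr ger0_norm.
  by rewrite ler_sqrt// /x ler_pdivlMr ?mulr_gt0//; lra.
have mr : 2 * m%:R ^+ 2 <= r / beta.
  have : m%:R ^+ 2 <= Num.sqrt x ^+ 2 by rewrite lerXn2r ?nnegrE ?sqrtr_ge0.
  rewrite sqr_sqrtr// => h.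
  have -> : r / beta = 2 * x by rewrite /x; field; rewrite gt_eqF.
  by rewrite ler_pM2l.
have nm : (8 * (m.+1 %/ 8) <= m.+1)%N by rewrite mulnC leq_trunc_div.
apply: le_trans (cbs_mean_abs_ge _ _ _ _ beta0 r0 pC m (m.+1 %/ 8) mr nm).
have : (m.+1 <= 8 * (m.+1 %/ 8) + 7)%N by clear; lia.
rewrite -(ler_nat R) natrD natrM lee_fin => hm; lra.
Qed.

(* The gain must tend to infinity with [k^3 <= r / beta] and [k f = O(r)]. *)
Definition gbs_gain {R : realType} (beta : R) (f : R -> R) (r : R) : nat :=
  maxn 1 (Num.truncn (Num.sqrt (Num.sqrt
    (Num.min (r / beta) (r / (2 * beta * (f r + 1))))))).

(** The fourth power of the gain is below both quotients. One yields the cubic bound; the other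
    yields [k beta (f + 1) <= r / 2], where the 1 covers the ceiling. [K] quantifies the divergence
    of the gain. *)
Lemma gbs_gainP (R : realType) (beta : R) (f : R -> R) (r : R) (K : nat) :
  0 < beta -> 0 < r -> 0 < f r ->
  K.+1%:R ^+ 4 <= r / beta -> K.+1%:R ^+ 4 <= r / (2 * beta * (f r + 1)) ->
  let k := gbs_gain beta f r in
  [/\ (K < k)%N, k%:R ^+ 3 <= r / beta
    & k%:R * (beta * (Num.ceil (r / beta + f r))%:~R - r) <= r / 2].
Proof.
move=> beta0 r0 f0 Kr Kf /=; rewrite /gbs_gain; set x := Num.min _ _.
have Kx : K.+1%:R ^+ 4 <= x by rewrite le_min Kr.
have x0 : 0 <= x by apply: le_trans Kx; rewrite exprn_ge0.
have Ks : K.+1%:R <= Num.sqrt (Num.sqrt x).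
  rewrite -[leLHS](ger0_norm (ler0n _ _)) -sqrtr_sqr ler_sqrt ?sqrtr_ge0//.
  rewrite -[leLHS](ger0_norm (sqr_ge0 _)) -sqrtr_sqr ler_sqrt//.
  by rewrite -exprM.
have Kk : (K < Num.truncn (Num.sqrt (Num.sqrt x)))%N by rewrite truncn_gt_nat.
rewrite (maxn_idPr _); last exact: leq_ltn_trans Kk.
set k := Num.truncn _ in Kk *.
have k4 : k%:R ^+ 4 <= x.
  have ks : k%:R <= Num.sqrt (Num.sqrt x) by rewrite truncn_le sqrtr_ge0.
  have -> : x = Num.sqrt (Num.sqrt x) ^+ 4.
    by rewrite (exprM _ 2 2) !sqr_sqrtr// ?sqrtr_ge0.
  by rewrite lerXn2r// nnegrE ?sqrtr_ge0.
have k1 : 1 <= k%:R :> R by rewrite ler1n; exact: leq_ltn_trans Kk.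
split => //.
  apply: le_trans (le_trans k4 _); last by rewrite ge_min lexx.
  by rewrite ler_weXn2l.
have f10 : 0 < f r + 1 by rewrite addr_gt0.
have kx : k%:R <= r / (2 * beta * (f r + 1)).
  apply: le_trans (le_trans k4 _); last by rewrite ge_min lexx orbT.
  by rewrite -[leLHS]expr1 ler_weXn2l.
have : beta * (Num.ceil (r / beta + f r))%:~R - r <= beta * (f r + 1).
  have := ceilB1_lt (r / beta + f r); rewrite intrB ltrBlDr => /ltW hc.
  have : beta * (Num.ceil (r / beta + f r))%:~R <= beta * (r / beta + f r + 1).
    by rewrite ler_pM2l.
  have -> : beta * (r / beta + f r + 1) = r + beta * (f r + 1).
    by field; rewrite gt_eqF.
  by rewrite lerBlDl.
move=> hM; apply: le_trans (ler_wpM2l (ler0n _ _) hM) _.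
have bf : 0 < beta * (f r + 1) by rewrite mulr_gt0.
apply: le_trans (ler_wpM2r (ltW bf) kx) _.
rewrite le_eqVlt; apply/orP; left; apply/eqP; field.
by rewrite !gt_eqF.
Qed.

(** * Existence of an admissible gain and the limit of the cost ratio *)

Theorem mainTheorem3 (R : realType) (beta h theta : R) (r : nat -> R)
    (f : R -> R) (beta_gt0 : 0 < beta) (h_gt0 : 0 < h) (theta_gt0 : 0 < theta)
    (r_gt0 : forall n, 0 < r n) (r_incr : nondecreasing_seq r)
    (r_infty : r n @[n --> \oo] --> +oo)
    (f_gt0 : forall n, 0 < f (r n))
    (f_small : f (r n) / r n @[n --> \oo] --> (0 : R))
    (f_large : f (r n) / Num.sqrt (r n) @[n --> \oo] --> +oo) :
  (exists (gamma : R -> nat) (piG : R -> state -> R),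
     gbs_admissible beta r f gamma piG) /\
  (forall (gamma : R -> nat) (piG : R -> state -> R)
          (X : R -> int) (piC : R -> state -> R),
     gbs_admissible beta r f gamma piG ->
     (forall n, cbs_stationary beta (r n) (X (r n)) (piC (r n))) ->
     (cost h theta (piG (r n)) / cost h theta (piC (r n)))%E
       @[n --> \oo] --> (0 : \bar R)).
Proof.
have sr0 n : 0 < Num.sqrt (r n) by rewrite sqrtr_gt0.
have mean0 (pi : R -> state -> R) n : (forall s, 0 <= pi (r n) s) ->
    (0 <= mean_abs_inventory (pi (r n)) / (Num.sqrt (r n))%:E)%E.
  move=> p0; rewrite mule_ge0 ?mean_abs_inventory_ge0//.
  by rewrite inve_ge0 lee_fin ltW.
split.
- pose gamma := gbs_gain beta f.
  have gamma0 x : (0 < gamma x)%N by rewrite leq_max.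
  have [piG piGP] : {piG : R -> state -> R & forall x, 0 < x -> 0 < f x ->
      gbs_stationary beta x (gamma x)%:R (f x) 0 (piG x) /\
      forall d : R, (gamma x)%:R * (beta * (Num.ceil (x / beta + f x))%:~R - x) <= x / 2 ->
        (gamma x)%:R ^+ 3 <= x / beta -> 0 < d ->
        (mean_abs_inventory (piG x)
           <= (d + 32 * (2 / ((gamma x)%:R * d) + (f x)^-1) * (x / beta))%:E)%E}.
    apply: (@choice _ _ (fun x p => 0 < x -> 0 < f x ->
      gbs_stationary beta x (gamma x)%:R (f x) 0 p /\
      forall d : R, (gamma x)%:R * (beta * (Num.ceil (x / beta + f x))%:~R - x) <= x / 2 ->
        (gamma x)%:R ^+ 3 <= x / beta -> 0 < d ->
        (mean_abs_inventory p
           <= (d + 32 * (2 / ((gamma x)%:R * d) + (f x)^-1) * (x / beta))%:E)%E)) => x.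
    have [[x0 fx0]|nx] := pselect (0 < x /\ 0 < f x); last first.
      (* Dummy value at the arguments where the premises fail. *)
      by exists (fun=> 0) => x0 fx0; exfalso; apply: nx.
    have [p [st bd]] := gbs_stationary_exists beta x (f x) (gamma x) beta_gt0 x0 fx0 (gamma0 x).
    by exists p.
  have st n := (piGP (r n) (r_gt0 n) (f_gt0 n)).1.
  exists gamma, piG; split => //.
  apply/cvge0P => [n|e e0].
    by apply: mean0; case: (st n) => p0 _ _ _; exact: p0.
  (* With [d = s / t], [s = sqrt r], [t = sqrt k], the terms in [d] and in [1 / d] add up to
     [C s / t]; [K] is chosen so that [k > K] forces [C / t <= e / 2]. *)
  pose C := 1 + 64 / beta.
  have C0 : 0 < C by rewrite addr_gt0// divr_gt0.
  pose K := Num.truncn ((2 * C / e) ^+ 2).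
  have hK : (2 * C / e) ^+ 2 <= K.+1%:R by apply/ltW; exact: truncnS_gt.
  pose Q : R := K.+1%:R ^+ 4.
  have Q0 : 0 < Q by rewrite exprn_gt0.
  have e10 : 0 < 4 * beta * Q by rewrite !mulr_gt0.
  near=> n.
  have rn1 : Q * beta <= r n.
    by near: n; move/cvgryPge: r_infty; exact.
  have rn2 : 4 * beta * Q <= r n.
    by near: n; move/cvgryPge: r_infty; exact.
  have fr : f (r n) / r n <= (4 * beta * Q)^-1.
    rewrite (le_trans (ler_norm _))//.
    by near: n; move/cvgr0Pnorm_le: f_small; apply; rewrite invr_gt0.
  have fs : 64 / (beta * e) <= f (r n) / Num.sqrt (r n).
    by near: n; move/cvgryPge: f_large; exact.
  have fn := f_gt0 n; have rn := r_gt0 n.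
  have [] := gbs_gainP R beta f (r n) K beta_gt0 rn fn.
  - by rewrite ler_pdivlMr.
  - rewrite ler_pdivlMr ?mulr_gt0 ?addr_gt0// -/Q.
    move: fr; rewrite ler_pdivrMr// mulrC ler_pdivlMr// => fr; lra.
  rewrite -/(gamma _); set k := gamma (r n) => Kk k3 kM.
  set s := Num.sqrt (r n); have s0 : 0 < s by exact: sr0.
  have rs : r n = s ^+ 2 by rewrite sqr_sqrtr// ltW.
  set t : R := Num.sqrt k%:R.
  have k0 : 0 < k%:R :> R by rewrite ltr0n gamma0.
  have t0 : 0 < t by rewrite sqrtr_gt0.
  have kt : k%:R = t ^+ 2 by rewrite sqr_sqrtr// ltW.
  (* This [d] balances [d] against [r / (k d)]. *)
  have d0 : 0 < s / t by rewrite divr_gt0.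
  have bd := (piGP (r n) rn fn).2 (s / t) kM k3 d0.
  rewrite inver gt_eqF// lee_pdivrMr// -EFinM; apply: le_trans bd _; rewrite lee_fin -/k.
  have -> : s / t + 32 * (2 / (k%:R * (s / t)) + (f (r n))^-1) * (r n / beta)
      = (C / t + 32 / beta * (s / f (r n))) * s.
    rewrite kt /C; move: (f (r n)) (fn) => w w0; rewrite rs.
    by field; rewrite !gt_eqF.
  rewrite ler_pM2r//.
  have h1 : C / t <= e / 2.
    rewrite ler_pdivrMr// -ler_pdivrMl ?divr_gt0//.
    have -> : (e / 2)^-1 * C = 2 * C / e by field; rewrite gt_eqF.
    rewrite -[leLHS]ger0_norm ?divr_ge0 ?mulr_ge0 ?(ltW C0) ?(ltW e0)//.
    by rewrite -sqrtr_sqr ler_sqrt ?ler0n// (le_trans hK)// ler_nat.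
  have h2 : 32 / beta * (s / f (r n)) <= e / 2.
    rewrite mulrA ler_pdivrMr// mulrAC ler_pdivrMr//.
    move: fs; rewrite -/s ler_pdivlMr// mulrAC ler_pdivrMr ?mulr_gt0// => fs.
    by lra.
  by rewrite [leRHS](splitr e) lerD.
- move=> gamma piG X piC [gamma0 stG cvG] stC.
  have pG0 n s : 0 <= piG (r n) s by case: (stG n).
  have pC0 n s : 0 <= piC (r n) s by case: (stC n).
  have [cvG' _] := cvge0P R _ (fun n => mean0 piG n (pG0 n)).
  apply/cvge0P => [n|e e0].
    by rewrite mule_ge0 ?inve_ge0 ?cost_ge0.
  (* [c * sqrt r] bounds the CBS cost from below, and [e'] solves [(h + theta) * e' = e * c]. *)
  pose c := Num.min h theta * (Num.sqrt (2 * beta)^-1 / 32).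
  have c0 : 0 < c.
    rewrite mulr_gt0 ?lt_min ?h_gt0//.
    by rewrite divr_gt0 ?sqrtr_gt0 ?invr_gt0 ?mulr_gt0.
  pose e' := e * c / (h + theta).
  have ht0 : 0 < h + theta by rewrite addr_gt0.
  have e'0 : 0 < e' by rewrite divr_gt0// mulr_gt0.
  near=> n.
  have rn : 512 * beta <= r n.
    by near: n; move/cvgryPge: r_infty; exact.
  have hG : (mean_abs_inventory (piG (r n)) / (Num.sqrt (r n))%:E <= e'%:E)%E.
    by near: n; exact: cvG'.
  have hC : ((c * Num.sqrt (r n))%:E <= cost h theta (piC (r n)))%E.
    apply: le_trans (cost_ge h theta _ (pC0 n)).
    have := cbs_mean_abs_sqrt R beta (r n) (X (r n)) (piC (r n)) beta_gt0 rn (stC n).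
    rewrite sqrtrM ?(ltW (r_gt0 n))// => hm.
    have mu0 : (0 <= (Num.min h theta)%:E :> \bar R)%E.
      by rewrite lee_fin le_min !ltW.
    apply: le_trans (lee_wpmul2l mu0 hm); rewrite -EFinM lee_fin /c.
    by rewrite le_eqVlt; apply/orP; left; apply/eqP; ring.
  have cs0 : 0 < c * Num.sqrt (r n) by rewrite mulr_gt0.
  have hG' : (cost h theta (piG (r n)) <= (e * (c * Num.sqrt (r n)))%:E)%E.
    apply: le_trans (cost_le h theta _ h_gt0 theta_gt0 (pG0 n)) _.
    move: hG; rewrite inver gt_eqF// lee_pdivrMr// -EFinM => hG.
    have ht0' : (0 <= (h + theta)%:E :> \bar R)%E by rewrite lee_fin ltW.
    apply: le_trans (lee_wpmul2l ht0' hG) _; rewrite -EFinM lee_fin /e'.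
    rewrite le_eqVlt; apply/orP; left; apply/eqP; field.
    by rewrite gt_eqF.
  (* Inversion is antitone on nonnegative extended reals, so an infinite CBS cost is covered as
     well. *)
  apply: (@le_trans _ _ ((e * (c * Num.sqrt (r n)))%:E * ((c * Num.sqrt (r n))%:E)^-1)%E).
    apply: lee_pmul => //; first exact: cost_ge0.
      by rewrite inve_ge0 cost_ge0.
    by rewrite lee_pV2// inE ?lee_fin ?(ltW cs0)//; exact: cost_ge0.
  by rewrite inver gt_eqF// lee_pdivrMr// -EFinM lee_fin.
Unshelve. all: by end_near. Qed.
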